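(* Let $M$ be a monoid with unit $1_M$ and let $A$ and $B$ be submonoids of $M$. Then $M$ is factorized by $A$ and $B$ if and only if the following three conditions hold: (i) $AB = M$; (ii) there exists a map $l : M \to A$ such that $l(am) = a\,l(m)$ for all $a \in A$ and $m \in M$, and $\mathrm{Ker}(l) = B$; (iii) there exists a map $r : M \to B$ such that $r(mb) = r(m)\,b$ for all $m \in M$ and $b \in B$, and $\mathrm{Ker}(r) = A$.
   Context: A monoid $M$ is factorized by its submonoids $A$ and $B$ if the multiplication map $A \times B \to M$, $(a,b) \mapsto ab$, is bijective (equivalently, each $m \in M$ can be written uniquely as $m = ab$ with $a \in A$, $b \in B$). For subsets $X, Y \subseteq M$, $XY = \{xy : x \in X, y \in Y\}$. For a map of sets $f$ from $M$ to a submonoid of $M$, $\mathrm{Ker}(f) = \{m \in M : f(m) = 1_M\}$. The maps $l$ and $r$ are maps of sets, not assumed to be homomorphisms. *)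

(* Defs.v *)
From mathcomp Require Import all_boot.
From mathcomp Require Import boolp classical_sets.

Set Implicit Arguments.
Unset Strict Implicit.
Unset Printing Implicit Defensive.

Local Open Scope classical_set_scope.
Local Open Scope group_scope.

(* Subsets of [M] are Prop-valued ([set M]), so that no decidability is assumed
   on submonoids; [A : set M] coerces to the type of its elements, hence
   [M -> A] below is the type of maps into [A]. *)
Definition submonoid (M : monoidType) (A : set M) : Prop :=
  monoid_closed [in A].

Definition mul_set (M : monoidType) (X Y : set M) : set M :=
  [set x * y | x in X & y in Y].

Definition mul_map (M : monoidType) (A B : set M) : A * B -> M :=
  fun p => val p.1 * val p.2.

Definition factorized (M : monoidType) (A B : set M) : Prop :=
  bijective (@mul_map M A B).

Definition Ker (M : monoidType) (A : set M) (f : M -> A) : set M :=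
  [set m | val (f m) = 1].

(* Main.v *)
Require Import Defs.
From mathcomp Require Import all_boot.
From mathcomp Require Import boolp classical_sets.

Local Open Scope classical_set_scope.
Local Open Scope group_scope.

(** If multiplication is bijective, [l] and [r] are the two coordinates of its inverse. Uniqueness
    turns [a * m = (a * l m) * r m] into equivariance of [l], and [l m = 1] means that [m = r m]
    lies in [B]; [r] is symmetric. Conversely, equivariance and the kernels give [l (a * b) = a] and
    [r (a * b) = b], so [(l, r)] inverts multiplication on [AB], which is all of [M]. *)

(** Uniqueness of factorization, phrased with membership so that it applies to products in [M] shown
    to lie in [A] or [B] by closure. *)
Lemma factorized_inverseM (M : monoidType) (A B : set M) (g : M -> A * B)
    (x y : M) :
  cancel (@mul_map M A B) g -> x \in A -> y \in B ->
  val (g (x * y)).1 = x /\ val (g (x * y)).2 = y.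
Proof. by move=> gK xA yB; rewrite (gK (Sub x xA, Sub y yB) : g (x * y) = _). Qed.

Theorem theorem2p12 (M : monoidType) (A B : set M)
    (hA : submonoid A) (hB : submonoid B) :
  factorized A B <->
  [/\ mul_set A B = [set: M],
      exists l : M -> A,
        (forall (a : A) (m : M), val (l (val a * m)) = val a * val (l m)) /\
        Ker l = B
    & exists r : M -> B,
        (forall (m : M) (b : B), val (r (m * val b)) = val (r m) * val b) /\
        Ker r = A].
Proof.
have [[A1 AM] [B1 BM]] := (hA, hB).
split=> [[g gK Kg]|[ABM [l [lM kerl]] [r [rM kerr]]]].
  have gE m : val (g m).1 * val (g m).2 = m := Kg m.
  have gM := factorized_inverseM _ _ _ _ _ _ gK.
  split.
  - apply/seteqP; split=> // m _.
    exists (val (g m).1); first exact/set_mem/valP.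
    by exists (val (g m).2); [exact/set_mem/valP|exact: gE].
  - exists (fun m => (g m).1); split=> [a m|].
      (* Regrouping puts the product of the two [A]-factors on the left, where closure of [A]
         applies. *)
      rewrite -{1}(gE m) mulgA.
      by have [->] := gM _ _ (AM _ _ (valP a) (valP (g m).1)) (valP (g m).2).
    apply/seteqP; split=> m; rewrite /Ker /=.
      by move=> gm1; move: (gE m); rewrite [val (g m).1]gm1 mul1g => <-; exact/set_mem/valP.
    (* An element [m] of [B] factors as [1 * m], so its [A]-part is [1]. *)
    by move=> /mem_set mB; have [+ _] := gM _ _ A1 mB; rewrite mul1g.
  - exists (fun m => (g m).2); split=> [m b|].
      rewrite -{1}(gE m) -mulgA.
      by have [_ ->] := gM _ _ (valP (g m).1) (BM _ _ (valP (g m).2) (valP b)).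
    apply/seteqP; split=> m; rewrite /Ker /=.
      by move=> gm1; move: (gE m); rewrite [val (g m).2]gm1 mulg1 => <-; exact/set_mem/valP.
    by move=> /mem_set mA; have [_ +] := gM _ _ mA B1; rewrite mulg1.
have lE (a : A) (b : B) : l (val a * val b) = a.
  apply: val_inj; rewrite lM.
  have -> : val (l (val b)) = 1.
    (* The equation is by conversion membership in [Ker l], which is [B]. *)
    by change (Ker l (val b)); rewrite kerl; exact/set_mem/valP.
  by rewrite mulg1.
have rE (a : A) (b : B) : r (val a * val b) = b.
  apply: val_inj; rewrite rM.
  have -> : val (r (val a)) = 1.
    by change (Ker r (val a)); rewrite kerr; exact/set_mem/valP.
  by rewrite mul1g.
exists (fun m => (l m, r m)) => [[a b]|m]; first by rewrite /mul_map lE rE.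
(* Since [AB = M], the right inverse law need only be checked on products, where [lE] and [rE]
   compute both coordinates. *)
have : mul_set A B m by rewrite ABM.
case=> x /mem_set xA [y /mem_set yB <-].
by rewrite /mul_map /= (lE (Sub x xA) (Sub y yB)) (rE (Sub x xA) (Sub y yB)).
Qed.
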